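(* Let $H$ be a complex Hilbert space, let $\mathcal{C}$ be a nonempty convex subset of $\widetilde{\mathbb{R}}^H$ and let $\Phi:\mathcal{C}\rightarrow\widetilde{\mathbb{R}}^H$ be a pointwise convex map. Then for any $f,g\in\mathcal{C}$, $$\Phi\big(f\nabla g\big)\leq\int_0^1\Phi\big(f\nabla_t g\big)\,dt\leq\mathbf{J}_\Phi(f,g)\leq\Phi(f)\nabla\Phi(g).$$ If $\Phi$ is pointwise concave, then these inequalities are reversed.
   Context: $\widetilde{\mathbb{R}}:=\mathbb{R}\cup\{+\infty\}$, and $\widetilde{\mathbb{R}}^H$ is the set of all functionals from $H$ to $\widetilde{\mathbb{R}}$. Inequalities between functionals are pointwise: $f\le g$ iff $f(x)\le g(x)$ for all $x\in H$. Algebraic operations and integrals of functionals are also pointwise in $x\in H$. For $t\in(0,1)$, $f\nabla_t g:=(1-t)f+tg$, with $f\nabla_0 g:=f$, $f\nabla_1 g:=g$, and $f\nabla g:=f\nabla_{1/2}g$. A map $\Phi:\mathcal{C}\to\widetilde{\mathbb{R}}^H$ is pointwise convex (resp. concave) if $\Phi(f\nabla_s g)\le\Phi(f)\nabla_s\Phi(g)$ (resp. $\ge$) for all $f,g\in\mathcal{C}$ and $s\in[0,1]$. For $\lambda\in(0,1)$, $\nu_\lambda$ is the probability measure on $[0,1]$ given by $$d\nu_\lambda(t)=\Big((1-\lambda)(1-t)^{\frac{1-2\lambda}{\lambda}}+\lambda t^{\frac{2\lambda-1}{1-\lambda}}\Big)dt.$$ Define $\mathcal{M}_\lambda(\Phi;f,g):=\int_0^1\Phi(f\nabla_t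 g)\,d\nu_\lambda(t)$ for $\lambda\in(0,1)$, and $\mathbf{J}_\Phi(f,g):=\int_0^1\mathcal{M}_\lambda(\Phi;f,g)\,d\lambda$. *)

(* Defs.v *)
From HB Require Import structures.
From mathcomp Require Import all_boot all_order all_algebra.
From mathcomp Require Import sesquilinear complex.
From mathcomp Require Import all_classical all_reals all_analysis.
From mathcomp Require Import measurable_realfun.
Set Implicit Arguments.
Unset Strict Implicit.
Unset Printing Implicit Defensive.
Import Order.TTheory GRing.Theory Num.Theory.
Import numFieldNormedType.Exports.
Local Open Scope classical_set_scope.
Local Open Scope ring_scope.
Local Open Scope ereal_scope.

Section Functionals.
Context {R : realType} {T : Type}.
Implicit Types (f g : T -> \bar R) (C : set (T -> \bar R)).

(* Functionals with values in R \cup {+oo}, as a subset of T -> \bar R. *)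
Definition rtilde_functional : set (T -> \bar R) :=
  [set f | forall x, f x != -oo].

Definition fle f g : Prop := forall x, f x <= g x.

Definition nabla (t : R) f g : T -> \bar R :=
  fun x => (1 - t)%:E * f x + t%:E * g x.

(* The conventions at t = 0 and t = 1 need no special case, because
   0 * +oo = 0 in \bar R. *)
Lemma nabla0 f g : nabla 0 f g = f.
Proof. by apply/funext => x; rewrite /nabla subr0 mul1e mul0e adde0. Qed.

Lemma nabla1 f g : nabla 1 f g = g.
Proof. by apply/funext => x; rewrite /nabla subrr mul1e mul0e add0e. Qed.

Definition convex_functionals C : Prop :=
  forall f g (s : R), C f -> C g -> (0 <= s <= 1)%R -> C (nabla s f g).

(* A map C -> rtilde_functional is represented by a total map Phi, of which
   only the values on C matter. *)
Definition pointwise_convex C (Phi : (T -> \bar R) -> (T -> \bar R)) : Prop :=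
  forall f g (s : R), C f -> C g -> (0 <= s <= 1)%R ->
    fle (Phi (nabla s f g)) (nabla s (Phi f) (Phi g)).

Definition pointwise_concave C (Phi : (T -> \bar R) -> (T -> \bar R)) : Prop :=
  forall f g (s : R), C f -> C g -> (0 <= s <= 1)%R ->
    fle (nabla s (Phi f) (Phi g)) (Phi (nabla s f g)).

End Functionals.

Section Nu.
Context {R : realType}.
Notation mu := (@lebesgue_measure R).

(* The value 0 for l outside ]0, 1[ is a default, which makes nu l a measure
   for every l. When the exponent of a base 0 is negative (t = 0 or t = 1),
   powR returns 0; this changes the density on a null set only. *)
Definition nu_pdf (l t : R) : R :=
  if (0 < l < 1)%R then
    ((1 - l) * ((1 - t) `^ ((1 - 2 * l) / l))
      + l * (t `^ ((2 * l - 1) / (1 - l))))%R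
  else 0%R.

Lemma nu_pdf_ge0 l t : (0 <= nu_pdf l t)%R.
Proof.
rewrite /nu_pdf; case: ifPn => // /andP[l0 l1].
by rewrite addr_ge0 ?mulr_ge0 ?powR_ge0 ?subr_ge0 ?ltW.
Qed.

Lemma measurable_nu_pdf l : measurable_fun [set: R] (nu_pdf l).
Proof.
rewrite /nu_pdf; case: (boolP (0 < l < 1)%R) => // _.
apply: measurable_funD.
  apply: measurable_funM => //.
  apply: (measurableT_comp (measurable_powR _)).
  exact: measurable_funB.
by apply: measurable_funM.
Qed.

Definition nu (l : R) : set (measurableTypeR R) -> \bar R :=
  fun A => \int[mu]_(t in A `&` `[0%R, 1%R]) (nu_pdf l t)%:E.

Let nu0 l : nu l set0 = 0.
Proof. by rewrite /nu set0I integral_set0. Qed.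

Let nu_ge0 l A : 0 <= nu l A.
Proof. by apply: integral_ge0 => t _; rewrite lee_fin nu_pdf_ge0. Qed.

Let nu_sigma_additive l : semi_sigma_additive (nu l).
Proof.
move=> /= F mF tF mUF; apply: cvg_toP.
  apply: ereal_nondecreasing_is_cvgn => m n mn.
  apply: lee_sum_nneg_natr => // k _ _; exact: nu_ge0.
rewrite /nu setI_bigcupl ge0_integral_bigcup//=.
- by move=> k; exact: measurableI.
- apply: measurable_funTS; apply: measurableT_comp => //.
  exact: measurable_nu_pdf.
- by move=> x _; rewrite lee_fin nu_pdf_ge0.
- exact: trivIset_setIr.
Qed.

HB.instance Definition _ l := isMeasure.Build _ _ _ (nu l)
  (nu0 l) (@nu_ge0 l) (@nu_sigma_additive l).

End Nu.

Section Means.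
Context {R : realType} {T : Type}.
Implicit Types (Phi : (T -> \bar R) -> (T -> \bar R)) (f g : T -> \bar R).

Definition mean_lebesgue Phi f g : T -> \bar R :=
  fun x => \int[lebesgue_measure]_(t in `[0%R, 1%R]) Phi (nabla t f g) x.

Definition mean_nu (l : R) Phi f g : T -> \bar R :=
  fun x => \int[nu l]_(t in `[0%R, 1%R]) Phi (nabla t f g) x.

(* mean_nu l is meaningful for l in ]0, 1[ only, hence the open interval. *)
Definition mean_J Phi f g : T -> \bar R :=
  fun x => \int[lebesgue_measure]_(l in `]0%R, 1%R[) mean_nu l Phi f g x.

End Means.

(* Main.v *)
Require Import Defs.
From mathcomp Require Import all_boot all_order all_algebra.
From mathcomp Require Import sesquilinear complex.
From mathcomp Require Import all_classical all_reals all_analysis.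
From mathcomp Require Import measurable_realfun ring lra.

(** Fix a point [x] of [H] and put [phi t := Phi (nabla t f g) x]. Since
    [nabla s (nabla a f g) (nabla b f g) = nabla ((1 - s) * a + s * b) f g]
    ([nabla_nabla]), pointwise convexity of [Phi] makes [phi] a convex function
    on [[0, 1]] with values in the reals extended by [+oo], and everything
    reduces to a statement about one such function.

    The key fact is that [nu l] is a probability measure with barycentre [l]:
    the functions [t |-> nu_pdf l t] and [t |-> t * nu_pdf l t] have explicit
    antiderivatives built from powers of [t] and [1 - t], whose increments over
    [[0, 1]] are [1] and [l]. Hence [nu l] integrates every affine function to
    its value at [l] ([integral_nu_affine]). Bounding [phi] below by a
    supporting line at [l] and above by its chord gives the weighted
    Hermite-Hadamard inequality
      [phi l <= \int[nu l] phi <= (1 - l) * phi 0 + l * phi 1]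
    ([le_jensen_nu], [nu_le_chord]). Integrating it over [l] in []0, 1[] gives
    the second and the third inequality of the theorem. Since [nu (1/2)] is the
    Lebesgue measure on [[0, 1]], the case [l = 1/2] gives the first one.

    Infinite values need care. A supporting line at [l] is guaranteed only if
    [phi] takes finite values on both sides of [l]. Otherwise [phi] is [+oo] on
    a nonempty open interval, which [nu l] charges, and [phi] is bounded below,
    so that its integral is [+oo] ([integral_nu_pinfty]). The Lebesgue integral,
    as the difference of two suprema over simple functions, is defined and
    monotone for arbitrary functions ([le_integral_pointwise]), so the
    measurability of [l |-> \int[nu l] phi] never has to be discussed.

    For concave [phi], a single infinite value forces [phi = +oo] on []0, 1[]
    ([concave01_pinfty]), and then both means are [+oo]. Otherwise [phi] is
    finite and the convex case applies to [- phi]. *)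

Set Implicit Arguments.
Unset Strict Implicit.
Unset Printing Implicit Defensive.
Import Order.TTheory GRing.Theory Num.Theory.
Import numFieldNormedType.Exports.
Local Open Scope ring_scope.
Local Open Scope classical_set_scope.

(** * Integrals of arbitrary functions, and measures with a density *)

Section IntegralFacts.
Local Open Scope ereal_scope.
Context d (T : measurableType d) (R : realType).
Variable mu : {measure set T -> \bar R}.
Implicit Types (D : set T) (f g : T -> \bar R).

(** The integral of a nonnegative function is a supremum over the simple
    functions below it, hence monotone without any measurability; the general
    case follows because [f <= g] reverses the order of the negative parts. *)
Lemma le_integral_pointwise D f g : (forall x, D x -> f x <= g x) ->
  \int[mu]_(x in D) f x <= \int[mu]_(x in D) g x.
Proof.
move=> fg; rewrite integralE [leRHS]integralE.
have le_nn h k : (forall x, D x -> 0 <= h x <= k x) ->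
    \int[mu]_(x in D) h x <= \int[mu]_(x in D) k x.
  move=> hk; rewrite !ge0_integralE; last 2 first.
  - by move=> x /hk /andP[h0 /(le_trans h0)].
  - by move=> x /hk /andP[].
  apply: le_ereal_sup => _ [s /= sh <-]; exists s => // x.
  by apply: le_trans (sh x) _; rewrite !patchE; case: ifPn => // /set_mem/hk/andP[].
apply: leeB; apply: le_nn => x Dx; apply/andP; split => //.
- by rewrite !funeposE ge_max !le_max fg ?lexx ?orbT.
- by rewrite !funenegE ge_max !le_max leeN2 fg ?lexx ?orbT.
Qed.

(** A finite integral rules out [+oo - oo] in the difference of the integrals
    of the positive and negative parts. *)
Lemma integralN_fin_num D f : \int[mu]_(x in D) f x \is a fin_num ->
  \int[mu]_(x in D) - f x = - \int[mu]_(x in D) f x.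
Proof.
move=> fin; apply: integralN; move: fin; rewrite integralE.
by case: (\int[mu]_(x in D) f^\+ x) => [?||]; case: (\int[mu]_(x in D) f^\- x).
Qed.

Section Density.
Variables (nu : {measure set T -> \bar R}) (p : T -> R) (D : set T).
Hypotheses (mD : measurable D) (mp : measurable_fun setT p).
Hypothesis p_ge0 : forall x, (0 <= p x)%R.
Hypothesis nuE : forall A, measurable A -> A `<=` D ->
  nu A = \int[mu]_(x in A) (p x)%:E.

Import HBNNSimple.

Let integral_density_nnsfun (h : {nnsfun T >-> R}) :
  \int[nu]_(x in D) (h x)%:E = \int[mu]_(x in D) ((h x)%:E * (p x)%:E).
Proof.
have mpE : measurable_fun D (EFin \o p).
  exact/measurable_EFinP/measurable_funTS.
under [LHS]eq_integral do rewrite fimfunE -fsumEFin//.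
rewrite [LHS]ge0_integral_fsum//; last 2 first.
  - by move=> r; exact/measurable_EFinP/measurableT_comp.
  - by move=> n x _; rewrite EFinM nnfun_muleindic_ge0.
under [RHS]eq_integral.
  move=> x xD; rewrite fimfunE -fsumEFin// ge0_mule_fsuml; last first.
    by move=> r; rewrite EFinM nnfun_muleindic_ge0.
  over.
rewrite [RHS]ge0_integral_fsum//; last 2 first.
  - move=> r; apply: emeasurable_funM => //; 
    exact/measurable_EFinP/measurableT_comp.
  - by move=> n x _; rewrite mule_ge0 ?lee_fin// -lee_fin EFinM nnfun_muleindic_ge0.
apply: eq_fsbigr => r _.
have mr : measurable (h @^-1` [set r]) by [].
have [r0|r0] := leP 0%R r; last first.
  have -> : h @^-1` [set r] = set0.
    by apply/seteqP; split => // x /= hxr; move: r0; rewrite -hxr ltNge fun_ge0.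
  rewrite !integral0_eq// => x _; rewrite indicE in_set0 mulr0//.
  by rewrite mul0e.
under eq_integral do rewrite EFinM.
under [RHS]eq_integral do rewrite EFinM -muleA.
have mr_indic : measurable_fun D (fun x => (\1_(h @^-1` [set r]) x : R)%:E).
  exact/measurable_EFinP/measurable_indic.
rewrite ge0_integralZl//.
rewrite ge0_integralZl//; last 2 first.
- exact: emeasurable_funM.
- by move=> x _; rewrite mule_ge0 ?lee_fin.
congr (_ * _); rewrite integral_indic// nuE//; last exact: measurableI.
rewrite integral_mkcondl; apply: eq_integral => x _.
by rewrite patchE indicE; case: ifPn => _; rewrite ?mul1e ?mul0e.
Qed.

(** The case of simple functions passes to the limit by monotone convergence
    on both sides. *)
Lemma ge0_integral_density f : measurable_fun D f ->
    (forall x, D x -> 0 <= f x) ->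
  \int[nu]_(x in D) f x = \int[mu]_(x in D) (f x * (p x)%:E).
Proof.
move=> mf f0; pose f_ := nnsfun_approx mD mf.
have mpE : measurable_fun D (EFin \o p).
  exact/measurable_EFinP/measurable_funTS.
transitivity (limn (fun n => \int[nu]_(x in D) (f_ n x)%:E)).
  rewrite -monotone_convergence//=.
  - apply: eq_integral => x /[!inE] xD; apply/esym/cvg_lim => //=.
    exact: cvg_nnsfun_approx.
  - by move=> n; apply: measurableT_comp => //; exact: measurable_funTS.
  - by move=> n x _; rewrite lee_fin.
  - by move=> x _ a b ab; rewrite lee_fin//; exact/lefP/nd_nnsfun_approx.
under eq_fun do rewrite integral_density_nnsfun.
rewrite -monotone_convergence//=.
- apply: eq_integral => x /[!inE] xD; apply/cvg_lim => //=.
  by apply: cvgeZr => //; exact: cvg_nnsfun_approx.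
- move=> n; apply: emeasurable_funM => //.
  by apply: measurableT_comp => //; exact: measurable_funTS.
- by move=> n x _; rewrite mule_ge0 ?lee_fin.
- move=> x _ a b ab; rewrite lee_wpmul2r ?lee_fin//.
  exact/lefP/nd_nnsfun_approx.
Qed.

End Density.
End IntegralFacts.

(** * Fundamental theorem of calculus on an open interval *)

Section ImproperFTC.
Local Open Scope ereal_scope.
Context {R : realType}.
Notation mu := (@lebesgue_measure R).

(** [f] may blow up at both ends, as [nu_pdf l] does; the open interval is
    exhausted by compact ones, where the usual theorem applies. *)
Lemma ge0_FTC2_oo (f F : R -> R) (a b : R) : (a < b)%R ->
  {in `]a, b[%R, forall x, {for x, continuous f}} ->
  {in `]a, b[%R, forall x, (0 <= f x)%R} ->
  {in `]a, b[%R, forall x, is_derive (x : R) (1%R : R) F (f x)} ->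
  F x @[x --> a^'+] --> F a -> F x @[x --> b^'-] --> F b ->
  \int[mu]_(x in `]a, b[) (f x)%:E = (F b - F a)%:E.
Proof.
move=> ab cf f0 dF Fa Fb.
(* n.+2 keeps the two end points a + e n and b - e n apart *)
pose e n : R := ((b - a) / 2 * n.+2%:R^-1)%R.
have e_gt0 n : (0 < e n)%R by rewrite /e !mulr_gt0 ?invr_gt0 ?subr_gt0.
have e_cvg : e n @[n --> \oo] --> (0 : R)%R.
  rewrite -(mulr0 ((b - a) / 2)%R); apply: cvgM; first exact: cvg_cst.
  have /= := @cvg_harmonic R.
  by rewrite -(cvg_shiftS (@harmonic R)).
have e_half n : (e n < (b - a) / 2)%R.
  rewrite /e gtr_pMr ?divr_gt0 ?subr_gt0// invf_lt1 ?ltr0n// ltr1n//.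
have e_le m n : (m <= n)%N -> (e n <= e m)%R.
  move=> mn; rewrite /e ler_pM2l ?divr_gt0 ?subr_gt0//.
  by rewrite lef_pV2 ?posrE ?ltr0n// ler_nat !ltnS.
pose I n := `[(a + e n)%R, (b - e n)%R]%classic.
have I_sub n : I n `<=` `]a, b[.
  move=> x; rewrite /I /= !in_itv/= => /andP[ax xb].
  by apply/andP; split; move: (e_gt0 n) ax xb; lra.
have mf : measurable_fun `]a, b[ (EFin \o f).
  apply/measurable_EFinP; apply: open_continuous_measurable_fun => //.
  by move=> x /set_mem; exact: cf.
have I_cup : \bigcup_n I n = `]a, b[.
  apply/seteqP; split; first by apply: bigcup_sub => n _; exact: I_sub.
  move=> x /=; rewrite in_itv/= => /andP[ax xb].
  have m0 : (0 < Num.min (x - a) (b - x))%R by rewrite lt_min !subr_gt0 ax.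
  have /cvgrPdist_lt/(_ _ m0)[N _ /(_ N (leqnn _))] := e_cvg.
  rewrite sub0r normrN gtr0_norm// lt_min => /andP[eN1 eN2].
  by exists N => //; rewrite /I /= in_itv/=; apply/andP; split; lra.
have FTC n : \int[mu]_(x in I n) (f x)%:E = (F (b - e n) - F (a + e n))%:E.
  have aebe : (a + e n < b - e n)%R by move: (e_half n); lra.
  have inI x : x \in `[(a + e n)%R, (b - e n)%R]%R -> x \in `]a, b[%R.
    exact: (I_sub n).
  have inIo x : x \in `](a + e n)%R, (b - e n)%R[%R -> x \in `]a, b[%R.
    by move=> xI; apply: inI; exact: subset_itv_oo_cc.
  have cF x : x \in `]a, b[%R -> {for x, continuous F}.
    move=> /dF dFx; apply/differentiable_continuous/derivable1_diffP.
    exact: ex_derive.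
  rewrite (continuous_FTC2 aebe (F := F)) ?EFinB//.
  - apply: continuous_in_subspaceT => x /set_mem xI; exact/cf/inI.
  - split.
    + by move=> x /inIo /dF dFx; exact: ex_derive.
    + by apply: cvg_at_right_filter; apply: cF; apply: inI; rewrite in_itv/= lexx ltW.
    + by apply: cvg_at_left_filter; apply: cF; apply: inI; rewrite in_itv/= lexx ltW.
  - by move=> x /inIo /dF dFx; rewrite derive1E derive_val.
have cvgI : \int[mu]_(x in I n) (f x)%:E @[n --> \oo] -->
    \int[mu]_(x in \bigcup_n I n) (f x)%:E.
  apply: ge0_nondecreasing_set_cvg_integral => //.
  - move=> m n mn; rewrite subsetEset => x; rewrite /I /= !in_itv/= => /andP[ax xb].
    by apply/andP; split; move: (e_le _ _ mn); lra.
  - by move=> n; exact: measurable_itv.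
  - by move=> n; exact: measurable_funS (I_sub n) mf.
  - by move=> n x /I_sub xI; rewrite lee_fin f0.
rewrite I_cup in cvgI.
have -> : \int[mu]_(x in `]a, b[) (f x)%:E =
    limn (fun n => \int[mu]_(x in I n) (f x)%:E) by apply/esym/cvg_lim.
under eq_fun do rewrite FTC.
apply/cvg_lim => //.
apply: cvg_EFin; first by near=> n.
apply: cvgB.
- apply: (cvg_at_leftP _ _ _).1 Fb _ _; split=> [n|].
    by rewrite gtrBl.
  by rewrite -[X in _ --> X]subr0; apply: cvgB => //; exact: cvg_cst.
- apply: (cvg_at_rightP _ _ _).1 Fa _ _; split=> [n|].
    by rewrite ltrDl.
  by rewrite -[X in _ --> X]addr0; apply: cvgD => //; exact: cvg_cst.
Unshelve. all: by end_near. Qed.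
End ImproperFTC.

(** * Total mass and first moment of the density of [nu l] *)

Section NuMoments.
Local Open Scope ereal_scope.
Context {R : realType}.
Notation mu := (@lebesgue_measure R).
Implicit Types (c l t x : R).

Lemma continuous_powR_gt0 c x : (0 < x)%R ->
  {for x, continuous (fun y : R => y `^ c)}%R.
Proof.
move=> x0; have := is_derive1_powR c x0 => dx.
by apply/differentiable_continuous/derivable1_diffP; exact: ex_derive.
Qed.

Lemma is_derive_onem_powR c x : (x < 1)%R ->
  is_derive x (1%R : R) (fun y : R => (1 - y) `^ c)%R (- (c * (1 - x) `^ (c - 1)))%R.
Proof.
move=> x1; have x0 : (0 < 1 - x)%R by rewrite subr_gt0.
have d1 : is_derive x (1%R : R) (fun y : R => 1 - y)%R (-1)%R.
  by apply: is_derive_eq; rewrite add0r mul1r.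
have := is_derive1_powR c x0 => d2.
have := @is_derive1_comp _ (fun y : R => y `^ c)%R (fun y : R => 1 - y)%R _ _ _ d2 d1.
by rewrite mulrN1.
Qed.

Lemma continuous_onem_powR_lt1 c x : (x < 1)%R ->
  {for x, continuous (fun y : R => (1 - y) `^ c)}%R.
Proof.
move=> x1; have := is_derive_onem_powR c x1 => dx.
by apply/differentiable_continuous/derivable1_diffP; exact: ex_derive.
Qed.

Lemma powR_cvg_right0 c : (0 < c)%R ->
  (x `^ c)%R @[x --> (0 : R)^'+] --> (0 `^ c)%R.
Proof. by move=> c0; rewrite powR0 ?gt_eqF//; exact: powR_cvg0. Qed.

Lemma onem_powR_cvg_left1 c : (0 < c)%R ->
  ((1 - x) `^ c)%R @[x --> (1 : R)^'-] --> ((1 - 1) `^ c)%R.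
Proof.
move=> c0; apply/cvg_at_leftP => u [u1 ucvg]; rewrite subrr.
apply: (cvg_at_rightP (fun y : R => y `^ c)%R _ _).1 (powR_cvg_right0 c0) _ _.
split=> [n|]; first by rewrite subr_gt0.
by rewrite -(subrr (1%R : R)); apply: cvgB => //; exact: cvg_cst.
Qed.

(** Writing the exponents as shifted inverses makes the antiderivatives below
    readable, and simplifies their derivatives and boundary values. *)
Lemma nu_pdfE l t : (0 < l < 1)%R ->
  nu_pdf l t =
    ((1 - l) * (1 - t) `^ (l^-1 - 2) + l * t `^ ((1 - l)^-1 - 2))%R.
Proof.
move=> l01; rewrite /nu_pdf l01; case/andP: l01 => l0 l1.
by congr (_ * _ `^ _ + _ * _ `^ _)%R; field; lra.
Qed.

Lemma continuous_nu_pdf l : (0 < l < 1)%R ->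
  {in `]0, 1[%R, forall t, {for t, continuous (nu_pdf l)}}%R.
Proof.
move=> l01 t; rewrite in_itv/= => /andP[t0 t1].
have -> : nu_pdf l = (fun t =>
    (1 - l) * (1 - t) `^ (l^-1 - 2) + l * t `^ ((1 - l)^-1 - 2))%R.
  by apply/funext => x; exact: nu_pdfE.
apply: cvgD; apply: cvgMr.
  exact: continuous_onem_powR_lt1.
exact: continuous_powR_gt0.
Qed.

Lemma integral_nu_pdf l : (0 < l < 1)%R ->
  \int[mu]_(t in `]0%R, 1%R[) (nu_pdf l t)%:E = 1.
Proof.
move=> l01; have /andP[l0 l1] := l01.
have a1 : (0 < l^-1 - 1)%R by rewrite subr_gt0 invf_gt1.
have b1 : (0 < (1 - l)^-1 - 1)%R by rewrite subr_gt0 invf_gt1; lra.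
pose F t := (- l * (1 - t) `^ (l^-1 - 1) + (1 - l) * t `^ ((1 - l)^-1 - 1))%R.
rewrite (@ge0_FTC2_oo _ _ F)//.
- by rewrite /F subrr subr0 !powR1 !powR0 ?gt_eqF//; congr EFin; ring.
- exact: continuous_nu_pdf.
- by move=> t _; exact: nu_pdf_ge0.
- move=> t; rewrite in_itv/= => /andP[t0 t1].
  have d1 := is_derive_onem_powR (l^-1 - 1) t1.
  have d2 := is_derive1_powR ((1 - l)^-1 - 1) t0.
  apply: is_derive_eq; rewrite nu_pdfE//.
  rewrite (_ : l^-1 - 1 - 1 = l^-1 - 2)%R; last by ring.
  rewrite (_ : (1 - l)^-1 - 1 - 1 = (1 - l)^-1 - 2)%R; last by ring.
  rewrite /GRing.scale/=; field; lra.
- apply: cvgD; apply: cvgMr.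
    by apply: cvg_at_right_filter; exact: continuous_onem_powR_lt1.
  exact: powR_cvg_right0.
- apply: cvgD; apply: cvgMr.
    exact: onem_powR_cvg_left1.
  by apply: cvg_at_left_filter; exact: continuous_powR_gt0.
Qed.

Lemma integral_id_nu_pdf l : (0 < l < 1)%R ->
  \int[mu]_(t in `]0%R, 1%R[) (t * nu_pdf l t)%:E = l%:E.
Proof.
move=> l01; have /andP[l0 l1] := l01.
have a1 : (0 < l^-1 - 1)%R by rewrite subr_gt0 invf_gt1.
have a0 : (0 < l^-1)%R by rewrite invr_gt0.
have b0 : (0 < (1 - l)^-1)%R by rewrite invr_gt0; lra.
pose F t := (l * (1 - l) * t `^ (1 - l)^-1 + - l * (1 - t) `^ (l^-1 - 1)
  + l * (1 - l) * (1 - t) `^ l^-1)%R.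
rewrite (@ge0_FTC2_oo _ _ F)//.
- by rewrite /F subrr subr0 !powR1 !powR0 ?gt_eqF//; congr EFin; ring.
- move=> t t01; apply: cvgM; [exact: cvg_id|exact: continuous_nu_pdf].
- move=> t; rewrite in_itv/= => /andP[t0 t1].
  by rewrite mulr_ge0 ?nu_pdf_ge0// ltW.
- move=> t; rewrite in_itv/= => /andP[t0 t1].
  have d1 := is_derive_onem_powR (l^-1 - 1) t1.
  have d2 := is_derive_onem_powR (l^-1) t1.
  have d3 := is_derive1_powR ((1 - l)^-1) t0.
  apply: is_derive_eq; rewrite nu_pdfE//.
  have pow_pred x c : (0 < x)%R -> (x `^ (c - 1) = x * x `^ (c - 2))%R.
    move=> x0; rewrite -{2}(powRr1 (ltW x0)) -powRD; last by rewrite (gt_eqF x0) implybT.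
    by congr (_ `^ _)%R; ring.
  rewrite (_ : l^-1 - 1 - 1 = l^-1 - 2)%R; last by ring.
  rewrite !pow_pred ?subr_gt0//.
  rewrite /GRing.scale/=; field; lra.
- apply: cvgD; last by apply: cvgMr; apply: cvg_at_right_filter; exact: continuous_onem_powR_lt1.
  apply: cvgD; apply: cvgMr; first exact: powR_cvg_right0.
  by apply: cvg_at_right_filter; exact: continuous_onem_powR_lt1.
- apply: cvgD; last by apply: cvgMr; exact: onem_powR_cvg_left1.
  apply: cvgD; apply: cvgMr; last exact: onem_powR_cvg_left1.
  by apply: cvg_at_left_filter; exact: continuous_powR_gt0.
Qed.

End NuMoments.

(** * Integration with respect to [nu l] *)

Section NuIntegrals.
Local Open Scope ereal_scope.
Context {R : realType}.
Notation mu := (@lebesgue_measure R).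
Implicit Types (l t a b : R).

Lemma nuE l (A : set (measurableTypeR R)) : A `<=` `[0%R, 1%R] ->
  nu l A = \int[mu]_(t in A) (nu_pdf l t)%:E.
Proof. by move=> A01; rewrite /nu setIidl. Qed.

Lemma ge0_integral_nu l (f : measurableTypeR R -> \bar R) :
    measurable_fun (`[0%R, 1%R] : set (measurableTypeR R)) f ->
    (forall t, `[0%R, 1%R]%classic t -> 0 <= f t) ->
  \int[nu l]_(t in `[0%R, 1%R]) f t =
  \int[mu]_(t in `[0%R, 1%R]) (f t * (nu_pdf l t)%:E).
Proof.
move=> mf f0; apply: (@ge0_integral_density _ _ _ mu (nu l) (nu_pdf l)) => //.
- exact: measurable_nu_pdf.
- exact: nu_pdf_ge0.
- by move=> A _; exact: nuE.
Qed.

(** At [l = 1/2] both exponents vanish and the density is constantly [1]. *)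
Lemma integral_nu_half (f : R -> \bar R) :
  \int[nu 2^-1]_(t in `[0%R, 1%R]) f t = \int[mu]_(t in `[0%R, 1%R]) f t.
Proof.
apply: (eq_measure_integral mu) => A mA A01.
rewrite /= nuE//; under eq_integral.
  move=> t _; rewrite nu_pdfE; last lra.
  rewrite (_ : (1 - 2^-1)^-1 - 2 = 0)%R; last by field.
  rewrite (_ : 2^-1^-1 - 2 = 0)%R; last by rewrite invrK subrr.
  rewrite !powRr0 !mulr1 subrK.
  over.
by rewrite integral_cst// mul1e.
Qed.

Lemma integral_nu1 l : (0 < l < 1)%R ->
  \int[nu l]_(t in `[0%R, 1%R]) (cst 1 t) = 1 :> \bar R.
Proof.
move=> l01; rewrite ge0_integral_nu//.
under eq_integral do rewrite mul1e.
rewrite integral_itv_bndoo ?integral_nu_pdf//.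
apply: measurable_funTS; apply: measurableT_comp => //.
exact: measurable_nu_pdf.
Qed.

Lemma integral_nu_id l : (0 < l < 1)%R ->
  \int[nu l]_(t in `[0%R, 1%R]) t%:E = l%:E.
Proof.
move=> l01; rewrite ge0_integral_nu//; last first.
  by move=> t; rewrite /= in_itv/= lee_fin => /andP[].
under eq_integral do rewrite -EFinM.
rewrite integral_itv_bndoo ?integral_id_nu_pdf//.
apply: measurable_funTS; apply: measurableT_comp => //.
apply: measurable_funM => //; exact: measurable_nu_pdf.
Qed.

(** This expresses that [nu l] is a probability measure with barycentre [l]. *)
Lemma integral_nu_affine l p q : (0 < l < 1)%R ->
  \int[nu l]_(t in `[0%R, 1%R]) (p + q * t)%:E = (p + q * l)%:E.
Proof.
move=> l01.
have m01 : measurable (`[0%R, 1%R] : set (measurableTypeR R)) by exact: measurable_itv.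
have i1 : (nu l).-integrable `[0%R, 1%R] (cst 1).
  apply/integrableP; split => //; under eq_integral do rewrite /= normr1.
  by rewrite (integral_nu1 l01) ltry.
have iid : (nu l).-integrable `[0%R, 1%R] (EFin : measurableTypeR R -> \bar R).
  apply/integrableP; split; first by exact: EFin_measurable.
  under eq_integral.
    move=> t /set_mem; rewrite /= in_itv/= => /andP[t0 _].
    rewrite ger0_norm//.
    over.
  by rewrite (integral_nu_id l01) ltry.
under eq_integral do rewrite EFinD EFinM -[p%:E]mule1.
rewrite integralD//; last 2 first.
- exact: (integrableZl _ _ i1).
- exact: (integrableZl _ _ iid).
by rewrite !integralZl// integral_nu1// integral_nu_id// mule1.
Qed.

(** The density is positive on []0, 1[], so it cannot vanish almost everywhere
    on an interval. *)
Lemma nu_itv_gt0 l a b : (0 < l < 1)%R -> (0 <= a)%R -> (a < b)%R -> (b <= 1)%R ->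
  0 < nu l (`]a, b[ : set R).
Proof.
move=> l01 a0 ab b1.
have sub01 : `]a, b[ `<=` `[0%R, 1%R]%classic.
  by move=> t /=; rewrite !in_itv/= => /andP[at_ tb]; apply/andP; split; lra.
rewrite lt0e measure_ge0 andbT; apply/negP => /eqP.
rewrite nuE// => int0.
have abs0 : \int[mu]_(t in `]a, b[) `|(nu_pdf l t)%:E| = 0.
  rewrite -[RHS]int0; apply: eq_integral => t _.
  by rewrite gee0_abs// lee_fin nu_pdf_ge0.
have mpdf : measurable_fun (`]a, b[ : set (measurableTypeR R)) (EFin \o nu_pdf l).
  apply: measurable_funTS; apply: measurableT_comp => //.
  exact: measurable_nu_pdf.
have [N [mN N0 sN]] := (ae_eq_integral_abs mu (measurable_itv _) mpdf).1 abs0.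
have : mu `]a, b[%classic = 0.
  apply: (subset_measure0 _ mN _ N0) => // t tab; apply: sN => /= pt0.
  move: (tab) (pt0 tab); rewrite /= in_itv/= => /andP[at_ tb].
  have t0 : (0 < t)%R by lra.
  have t1 : (0 < 1 - t)%R by lra.
  case/andP: l01 => l0 l1; rewrite nu_pdfE ?l0// => -[] /eqP.
  rewrite gt_eqF// addr_gt0// mulr_gt0 ?powR_gt0//; lra.
by rewrite lebesgue_measure_itv/= lte_fin ab -EFinB => -[]; lra.
Qed.

(** The lower bound keeps the negative part integrable, so that [+oo - oo] does
    not occur. *)
Lemma integral_nu_pinfty l a b m (f : R -> \bar R) : (0 < l < 1)%R ->
    (0 <= a)%R -> (a < b)%R -> (b <= 1)%R ->
    {in `[0, 1]%R, forall t, m%:E <= f t} -> {in `]a, b[%R, forall t, f t = +oo} ->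
  \int[nu l]_(t in `[0%R, 1%R]) f t = +oo.
Proof.
move=> l01 a0 ab b1 mf fy.
have -> : \int[nu l]_(t in `[0%R, 1%R]) f t =
    \int[nu l]_(t in `[0%R, 1%R]) f^\+ t - \int[nu l]_(t in `[0%R, 1%R]) f^\- t.
  exact: integralE.
have -> : \int[nu l]_(t in `[0%R, 1%R]) f^\+ t = +oo.
  apply/eqP; rewrite eq_le leey /=.
  apply: (@le_trans _ _ (\int[nu l]_(t in `[0%R, 1%R]) ((cst +oo) \_ `]a, b[) t)).
    rewrite -integral_mkcondr setIidr; last first.
      by move=> t /=; rewrite !in_itv/= => /andP[at_ tb]; apply/andP; split; lra.
    rewrite integral_cst//.
    by rewrite gt0_mulye// nu_itv_gt0.
  apply: le_integral_pointwise => t t01; rewrite patchE funeposE.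
  by case: ifPn => [/set_mem/fy ->|_]; rewrite le_max lexx ?orbT.
rewrite addye// eqe_oppLR/= -ltey.
apply: le_lt_trans (ltry `|m|%R).
apply: (@le_trans _ _ (\int[nu l]_(t in `[0%R, 1%R]) (`|m| + 0 * t)%R%:E)).
  apply: le_integral_pointwise => t t01; rewrite mul0r addr0 funenegE ge_max.
  rewrite lee_fin normr_ge0 andbT leeNl; apply: le_trans (mf _ t01).
  by rewrite -EFinN lee_fin lerNl -normrN ler_norm.
by rewrite integral_nu_affine// mul0r addr0.
Qed.

End NuIntegrals.

(** * Extended-valued convex functions on the unit interval *)

Section ConvexLine.
Local Open Scope ereal_scope.
Context {R : realType}.
Implicit Types (a b c l m p q s t : R) (phi : R -> \bar R).

(** The slope is the supremum of the slopes of the chords that end at [c] from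
    the left; those that start at [c] bound it from above. The set [D] is there
    to be the domain of finiteness of an extended-valued function. *)
Lemma support_line (h : R -> R) (D : set R) a b c :
    D a -> D b -> (a < c < b)%R ->
    (forall x y, D x -> D y -> (x < c < y)%R ->
      (y - x) * h c <= (y - c) * h x + (c - x) * h y)%R ->
  exists k, forall t, D t -> (h c + k * (t - c) <= h t)%R.
Proof.
move=> Da Db /andP[ac cb] hconv.
pose S := [set ((h c - h t) / (c - t))%R | t in [set t | D t /\ (t < c)%R]].
have S_ub u : D u -> (c < u)%R -> ubound S ((h u - h c) / (u - c))%R.
  move=> Du cu _ [t [Dt tc] <-].
  have ct : (0 < c - t)%R by rewrite subr_gt0.
  have uc : (0 < u - c)%R by rewrite subr_gt0.
  rewrite ler_pdivrMr// mulrAC ler_pdivlMr//.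
  by have := hconv _ _ Dt Du; rewrite tc cu => /(_ isT); nra.
have supS : has_sup S.
  split; first by exists ((h c - h a) / (c - a))%R; exists a.
  by exists ((h b - h c) / (b - c))%R; exact: S_ub.
exists (sup S) => t Dt; have [tc|ct|->] := ltgtP t c.
- have : ((h c - h t) / (c - t) <= sup S)%R.
    by apply: (ub_le_sup supS.2); exists t.
  by rewrite ler_pdivrMr ?subr_gt0//; lra.
- have : (sup S <= (h t - h c) / (t - c))%R.
    by apply: (ge_sup supS.1); exact: S_ub.
  by rewrite ler_pdivlMr ?subr_gt0//; lra.
- by rewrite subrr mulr0 addr0.
Qed.

Definition convex01 phi := forall a b s, (0 <= a <= 1)%R -> (0 <= b <= 1)%R ->
  (0 <= s <= 1)%R ->
  phi ((1 - s) * a + s * b)%R <= (1 - s)%:E * phi a + s%:E * phi b.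

Section Jensen.
Variable phi : R -> \bar R.
Hypotheses (phiC : convex01 phi) (phiNy : forall t, (0 <= t <= 1)%R -> phi t != -oo).

Let fin a : (0 <= a <= 1)%R -> phi a < +oo -> exists r, phi a = r%:E.
Proof. by move=> /phiNy; case: (phi a) => // r _ _; exists r. Qed.

Lemma convex01_chord a b c : (0 <= a)%R -> (b <= 1)%R -> (a < c < b)%R ->
    phi a < +oo -> phi b < +oo ->
  phi c < +oo /\
  ((b - a) * fine (phi c) <= (b - c) * fine (phi a) + (c - a) * fine (phi b))%R.
Proof.
move=> a0 b1 /andP[ac cb].
have ab : (0 < b - a)%R by lra.
have a01 : (0 <= a <= 1)%R by apply/andP; split; lra.
have b01 : (0 <= b <= 1)%R by apply/andP; split; lra.
have c01 : (0 <= c <= 1)%R by apply/andP; split; lra.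
move=> /(fin a01)[x phia] /(fin b01)[y phib].
have s01 : (0 <= (c - a) / (b - a) <= 1)%R.
  by rewrite ler_pdivrMr// mul1r divr_ge0 ?subr_ge0 ?ltW//=; lra.
have := phiC a01 b01 s01; rewrite phia phib.
have -> : ((1 - (c - a) / (b - a)) * a + (c - a) / (b - a) * b = c)%R.
  by field; lra.
have := phiNy c01; case: (phi c) => // z _; rewrite -!EFinM -EFinD lee_fin => zle.
split; first exact: ltry.
rewrite /= (_ : _ + _ = (b - a) * ((1 - (c - a) / (b - a)) * x + (c - a) / (b - a) * y))%R.
  by rewrite ler_pM2l.
by field; lra.
Qed.

Lemma convex01_minorant a b c : (0 <= a)%R -> (b <= 1)%R -> (a < c < b)%R ->
    phi a < +oo -> phi b < +oo ->
  exists p q, phi c = (p + q * c)%:E /\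
    forall t, (0 <= t <= 1)%R -> (p + q * t)%:E <= phi t.
Proof.
move=> a0 b1 acb phia phib; have /andP[ac cb] := acb.
have [phic _] := convex01_chord a0 b1 acb phia phib.
have c01 : (0 <= c <= 1)%R by apply/andP; split; lra.
have [z phicz] := fin c01 phic.
pose D : set R := [set t | (0 <= t <= 1)%R /\ phi t < +oo].
have Da : D a by split => //; apply/andP; split; lra.
have Db : D b by split => //; apply/andP; split; lra.
have [|k kP] := @support_line (fine \o phi) D _ _ _ Da Db acb.
  move=> x y [/andP[x0 _] phix] [/andP[_ y1] phiy] xcy /=.
  exact: (convex01_chord x0 y1 xcy phix phiy).2.
exists (z - k * c)%R, k; split; first by rewrite phicz; congr EFin; ring.
move=> t t01; have [phit|] := ltP (phi t) +oo; last first.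
  by rewrite leye_eq => /eqP ->; rewrite leey.
have [w phitw] := fin t01 phit.
have := kP t (conj t01 phit); rewrite /= phicz phitw lee_fin /=; lra.
Qed.

(** With two finite values, an affine minorant exists; with at most one, [phi]
    is [+oo] elsewhere. *)
Lemma convex01_lbounded : exists m, forall t, (0 <= t <= 1)%R -> m%:E <= phi t.
Proof.
have [[a [b [[a0 ab b1] [phia phib]]]]|single] := pselect (exists a b,
    [/\ 0 <= a, a < b & b <= 1]%R /\ phi a < +oo /\ phi b < +oo).
  have amb : (a < (a + b) / 2 < b)%R by apply/andP; split; lra.
  have [p [q [_ pqP]]] := convex01_minorant a0 b1 amb phia phib.
  exists (p - `|q|)%R => t t01; apply: le_trans (pqP t t01).
  rewrite lee_fin lerD2l lerNl; apply: le_trans (ler_norm _) _.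
  case/andP: t01 => t0 t1.
  by rewrite normrN normrM (ger0_norm t0) ler_piMr.
have [[a [a01 phia]]|none] := pselect (exists a, (0 <= a <= 1)%R /\ phi a < +oo).
  exists (fine (phi a)) => t t01; have [r phiar] := fin a01 phia.
  case/andP: (a01) (t01) => a0 a1 /andP[t0 t1].
  have [phit|] := ltP (phi t) +oo; last by rewrite leye_eq => /eqP ->; rewrite leey.
  have [ta|at_|->] := ltgtP t a; last by rewrite phiar.
  - by exfalso; apply: single; exists t, a.
  - by exfalso; apply: single; exists a, t.
exists 0%R => t t01; have [phit|] := ltP (phi t) +oo; last first.
  by rewrite leye_eq => /eqP ->; rewrite leey.
by exfalso; apply: none; exists t.
Qed.

(** Jensen's inequality at the barycentre [l]. If [phi] is [+oo] on one whole
    side of [l], there may be no affine minorant that is exact at [l], since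
    [phi] may jump there, but the integral is then [+oo]. *)
Lemma le_jensen_nu l : (0 < l < 1)%R ->
  phi l <= \int[nu l]_(t in `[0%R, 1%R]) phi t.
Proof.
move=> l01; have /andP[l0 l1] := l01; have [m mP] := convex01_lbounded.
have mP' : {in `[0, 1]%R, forall t, m%:E <= phi t} by move=> t; rewrite in_itv; exact: mP.
have [[a [a0 al phia]]|noa] := pselect (exists a, [/\ (0 <= a)%R, (a < l)%R & phi a < +oo]); last first.
  rewrite (integral_nu_pinfty (a := 0%R) (b := l) l01 _ _ _ mP') ?leey// ?ltW//.
  move=> t; rewrite in_itv/= => /andP[t0 tl]; apply/eqP; rewrite -leye_eq leNgt.
  by apply/negP => phit; apply: noa; exists t; rewrite ltW.
have [[b [lb b1 phib]]|nob] := pselect (exists b, [/\ (l < b)%R, (b <= 1)%R & phi b < +oo]); last first.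
  rewrite (integral_nu_pinfty (a := l) (b := 1%R) l01 _ _ _ mP') ?leey// ?ltW//.
  move=> t; rewrite in_itv/= => /andP[lt t1]; apply/eqP; rewrite -leye_eq leNgt.
  by apply/negP => phit; apply: nob; exists t; rewrite (ltW t1).
have alb : (a < l < b)%R by rewrite al.
have [p [q [-> pqP]]] := convex01_minorant a0 b1 alb phia phib.
rewrite -(integral_nu_affine p q l01); apply: le_integral_pointwise => t /=.
by rewrite in_itv; exact: pqP.
Qed.

(** An infinite end value makes the chord infinite at the interior point [l];
    otherwise the chord is affine. *)
Lemma nu_le_chord l : (0 < l < 1)%R ->
  \int[nu l]_(t in `[0%R, 1%R]) phi t <= (1 - l)%:E * phi 0%R + l%:E * phi 1%R.
Proof.
move=> l01; have /andP[l0 l1] := l01.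
have h0 : (0 <= (0 : R) <= 1)%R by rewrite lexx ler01.
have h1 : (0 <= (1 : R) <= 1)%R by rewrite lexx ler01.
have [phi0|] := ltP (phi 0%R) +oo; last first.
  rewrite leye_eq => /eqP ->; rewrite gt0_muley ?lte_fin ?subr_gt0// addye ?leey//.
  by have := phiNy h1; case: (phi 1%R) => [r||]//; rewrite gt0_muley.
have [phi1|] := ltP (phi 1%R) +oo; last first.
  rewrite leye_eq => /eqP ->; rewrite [l%:E * _]gt0_muley ?lte_fin// addey ?leey//.
  by have [r ->] := fin h0 phi0.
have [x phi0x] := fin h0 phi0; have [y phi1y] := fin h1 phi1.
rewrite phi0x phi1y -!EFinM -EFinD.
rewrite (_ : (1 - l) * x + l * y = x + (y - x) * l)%R; last by ring.
rewrite -(integral_nu_affine _ _ l01); apply: le_integral_pointwise => t /=.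
rewrite in_itv/= => t01; have := phiC h0 h1 t01.
rewrite mulr0 add0r mulr1 phi0x phi1y -!EFinM -EFinD => /le_trans; apply.
by rewrite lee_fin; lra.
Qed.

(** Strict sublevel sets of a convex function are intervals. Measurability lets
    the end points be dropped when [phi] itself is integrated. *)
Lemma measurable_convex01 :
  measurable_fun (`[0%R, 1%R] : set (measurableTypeR R)) phi.
Proof.
move=> _; apply: (measurability _ (ErealGenInftyO.measurableE R)) => //.
move=> _ [_ [r ->] <-]; apply: is_interval_measurable => x y /=.
rewrite !in_itv/= => -[/andP[x0 x1] phix] [/andP[y0 y1] phiy] z /andP[xz zy].
split; first by rewrite in_itv/=; apply/andP; split; lra.
move: xz zy; rewrite in_itv/= !le_eqVlt.
move=> /predU1P[<- //|xz] /predU1P[-> //|zy].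
have z01 : (0 <= z <= 1)%R by apply/andP; split; lra.
have xzy : (x < z < y)%R by rewrite xz.
have phixy : phi x < +oo by rewrite (lt_trans phix) ?ltry.
have phiyy : phi y < +oo by rewrite (lt_trans phiy) ?ltry.
have [phiz] := convex01_chord x0 y1 xzy phixy phiyy.
have x01 : (0 <= x <= 1)%R by rewrite x0.
have y01 : (0 <= y <= 1)%R by rewrite y0.
have [u phixu] := fin x01 phixy; have [v phiyv] := fin y01 phiyy.
have [w phizw] := fin z01 phiz.
move: phix phiy; rewrite phixu phiyv phizw !lte_fin /=; nra.
Qed.

End Jensen.
End ConvexLine.

(** * The chain of inequalities for one function of one variable *)

Section HermiteHadamard.
Local Open Scope ereal_scope.
Context {R : realType}.
Notation mu := (@lebesgue_measure R).
Implicit Types (a b l s t : R) (phi : R -> \bar R) (u v : \bar R).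

Definition concave01 phi := forall a b s, (0 <= a <= 1)%R -> (0 <= b <= 1)%R ->
  (0 <= s <= 1)%R ->
  (1 - s)%:E * phi a + s%:E * phi b <= phi ((1 - s) * a + s * b)%R.

Definition mean_nu01 phi l := \int[nu l]_(t in `[0%R, 1%R]) phi t.
Definition mean_J01 phi := \int[mu]_(l in `]0%R, 1%R[) mean_nu01 phi l.
Definition mean_leb01 phi := \int[mu]_(t in `[0%R, 1%R]) phi t.

Lemma chord_cases l u v : (0 < l < 1)%R -> u != -oo -> v != -oo ->
  (1 - l)%:E * u + l%:E * v = +oo \/ exists x y, u = x%:E /\ v = y%:E.
Proof.
move=> /andP[l0 l1].
have l1' : (0 < 1 - l)%R by lra.
case: u => [x||] // _; case: v => [y||] // _; [right|left..].
- by exists x, y.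
- by rewrite gt0_muley// addey.
- by rewrite gt0_muley// addye.
- by rewrite !gt0_muley.
Qed.

Lemma convex01_hermite_hadamard phi : convex01 phi ->
    (forall t, (0 <= t <= 1)%R -> phi t != -oo) ->
  [/\ phi 2^-1%R <= mean_leb01 phi,
      mean_leb01 phi <= mean_J01 phi
    & mean_J01 phi <= (1 - 2^-1)%:E * phi 0%R + (2^-1)%:E * phi 1%R].
Proof.
move=> phiC phiNy.
have half01 : (0 < (2^-1 : R) < 1)%R by apply/andP; split; lra.
split.
- by rewrite /mean_leb01 -integral_nu_half; exact: le_jensen_nu.
- have mphi : measurable_fun (`]0%R, 1%R[ : set (measurableTypeR R)) phi.
    apply: (measurable_funS _ _ (measurable_convex01 phiC phiNy)) => //.
    exact: subset_itv_oo_cc.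
  rewrite /mean_leb01 integral_itv_bndoo//; apply: le_integral_pointwise => l /=.
  by rewrite in_itv/=; exact: le_jensen_nu.
- have [->|[x [y [phi0 phi1]]]] := chord_cases half01
      (phiNy 0%R ltac:(by rewrite lexx ler01)) (phiNy 1%R ltac:(by rewrite lexx ler01)).
    exact: leey.
  apply: (@le_trans _ _ (\int[mu]_(l in `]0%R, 1%R[) (x + (y - x) * l)%:E)).
    apply: le_integral_pointwise => l /=; rewrite in_itv/= => l01.
    apply: le_trans (nu_le_chord phiC phiNy l01) _.
    by rewrite phi0 phi1 -!EFinM -EFinD lee_fin; lra.
  rewrite -(@integral_itv_bndoo _ _ _ _ true false); last first.
    apply: measurable_funTS; apply: measurableT_comp => //.
    by apply: measurable_funD => //; exact: measurable_funM.
  rewrite -integral_nu_half integral_nu_affine// phi0 phi1 -!EFinM -EFinD lee_fin; lra.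
Qed.

(** Every point of []0, 1[] other than [p] lies strictly between [p] and an end
    point, with a positive weight on [p]. *)
Lemma concave01_pinfty phi p : concave01 phi ->
    (forall t, (0 <= t <= 1)%R -> phi t != -oo) ->
    (0 <= p <= 1)%R -> phi p = +oo ->
  {in `]0, 1[%R, forall t, phi t = +oo}.
Proof.
move=> phiC phiNy p01 phip t; rewrite in_itv/= => /andP[t0 t1].
have h0 : (0 <= (0 : R) <= 1)%R by rewrite lexx ler01.
have h1 : (0 <= (1 : R) <= 1)%R by rewrite lexx ler01.
have scaleNy r q : (0 <= q <= 1)%R -> (0 <= r)%R -> r%:E * phi q != -oo.
  move=> /phiNy; case: (phi q) => // _; rewrite le_eqVlt => /predU1P[<-|r0].
    by rewrite mul0e.
  by rewrite gt0_muley.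
apply/eqP; rewrite -leye_eq; have [pt|tp|<-] := ltgtP p t; last by rewrite phip.
- have p1 : (0 < 1 - p)%R by lra.
  have s01 : (0 <= (t - p) / (1 - p) < 1)%R.
    rewrite ltr_pdivrMr// mul1r divr_ge0 ?subr_ge0 ?ltW//=; lra.
  have /andP[s0 s1] := s01.
  have := phiC p 1%R ((t - p) / (1 - p))%R p01 h1; rewrite s0 (ltW s1) => /(_ isT).
  rewrite phip gt0_muley ?lte_fin ?subr_gt0//.
  rewrite addye ?scaleNy//.
  suff -> : ((1 - (t - p) / (1 - p)) * p + (t - p) / (1 - p) * 1 = t)%R by [].
  by field; lra.
- have p0 : (0 < p)%R by lra.
  have s01 : (0 < t / p <= 1)%R.
    by rewrite ler_pdivrMr// mul1r divr_gt0//= ltW.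
  have /andP[s0 s1] := s01.
  have := phiC 0%R p (t / p)%R h0 p01; rewrite (ltW s0) s1 => /(_ isT).
  rewrite phip [X in _ + X]gt0_muley ?lte_fin// addey ?scaleNy ?subr_ge0//.
  suff -> : ((1 - t / p) * 0 + t / p * p = t)%R by [].
  by field; lra.
Qed.

Lemma concave01_hermite_hadamard phi : concave01 phi ->
    (forall t, (0 <= t <= 1)%R -> phi t != -oo) ->
  [/\ (1 - 2^-1)%:E * phi 0%R + (2^-1)%:E * phi 1%R <= mean_J01 phi,
      mean_J01 phi <= mean_leb01 phi
    & mean_leb01 phi <= phi 2^-1%R].
Proof.
move=> phiC phiNy.
have half01 : (0 < (2^-1 : R) < 1)%R by apply/andP; split; lra.
have h0 : (0 <= (0 : R) <= 1)%R by rewrite lexx ler01.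
have h1 : (0 <= (1 : R) <= 1)%R by rewrite lexx ler01.
have [[p [p01 phip]]|nop] := pselect (exists p, (0 <= p <= 1)%R /\ phi p = +oo).
  have phiy := concave01_pinfty phiC phiNy p01 phip.
  have lb q : (0 <= q <= 1)%R -> exists r, r%:E <= phi q.
    by move=> /phiNy; case: (phi q) => [r||]// _; [exists r|exists 0%R; rewrite leey].
  have [r0 r0P] := lb _ h0; have [r1 r1P] := lb _ h1.
  have mP : {in `[0, 1]%R, forall t, (Num.min r0 r1)%:E <= phi t}.
    move=> t; rewrite in_itv/= => /andP[].
    rewrite [(0 <= t)%R]le_eqVlt [(t <= 1)%R]le_eqVlt.
    move=> /predU1P[<- _|t0 /predU1P[->|t1]].
    - by apply: le_trans r0P; rewrite lee_fin ge_min lexx.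
    - by apply: le_trans r1P; rewrite lee_fin ge_min lexx orbT.
    - by rewrite phiy ?leey// in_itv/= t0.
  have nuy l : (0 < l < 1)%R -> mean_nu01 phi l = +oo.
    by move=> l01; exact: (integral_nu_pinfty l01 (lexx _) ltr01 (lexx _) mP phiy).
  rewrite /mean_leb01 -integral_nu_half [integral _ _ _](nuy _ half01).
  rewrite [phi 2^-1%R]phiy ?in_itv//=; split => //; last exact: leey.
  rewrite /mean_J01 (eq_integral (cst +oo)); last first.
    by move=> l /set_mem; rewrite /= in_itv/=; exact: nuy.
  rewrite integral_cst//= lebesgue_measure_itv/= lte_fin ltr01 -EFinB subr0.
  by rewrite mule1 leey.
have phifin t : (0 <= t <= 1)%R -> exists r, phi t = r%:E.
  move=> t01; have := phiNy t t01; case E : (phi t) => [r||]// _.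
    by exists r.
  by exfalso; apply: nop; exists t.
(* all values are finite from here on, so negation loses nothing *)
pose psi t := - phi t.
have psiC : convex01 psi.
  move=> a b s a01 b01 s01; have := phiC a b s a01 b01 s01; rewrite /psi.
  have [x ->] := phifin a a01; have [y ->] := phifin b b01.
  by rewrite -leeN2 -!EFinN -!EFinM -!EFinD; congr (_ <= _); congr EFin; ring.
have psiNy t : (0 <= t <= 1)%R -> psi t != -oo.
  by move=> /phifin[r]; rewrite /psi => ->.
have [H1 H2 H3] := convex01_hermite_hadamard psiC psiNy.
have [x phi0] := phifin _ h0; have [y phi1] := phifin _ h1.
have [z phiz] := phifin 2^-1%R ltac:(by apply/andP; split; lra).
have fin_between (r1 r2 : R) (e : \bar R) : r1%:E <= e -> e <= r2%:E -> e \is a fin_num.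
  by case: e.
have phi_opp : (fun t => - psi t) = phi by apply/funext => t; rewrite /psi oppeK.
have nu_opp l : (0 < l < 1)%R -> mean_nu01 phi l = - mean_nu01 psi l.
  move=> l01; rewrite /mean_nu01 -integralN_fin_num; first by rewrite phi_opp.
  have [w phiw] := phifin l ltac:(by case/andP: l01 => ? ?; apply/andP; split; lra).
  have lo := le_jensen_nu psiC psiNy l01.
  have hi := nu_le_chord psiC psiNy l01.
  move: lo hi; rewrite /psi phiw phi0 phi1 -!EFinN -!EFinM -EFinD.
  exact: fin_between.
move: H1 H2 H3; rewrite {1}/psi phiz [psi 0%R]/psi [psi 1%R]/psi phi0 phi1.
rewrite -!EFinN -!EFinM -!EFinD => H1 H2 H3.
have J_opp : mean_J01 phi = - mean_J01 psi.
  rewrite /mean_J01 -integralN_fin_num; last first.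
    exact: fin_between (le_trans H1 H2) H3.
  by apply: eq_integral => l /set_mem; rewrite /= in_itv/=; exact: nu_opp.
have leb_opp : mean_leb01 phi = - mean_leb01 psi.
  rewrite /mean_leb01 -integralN_fin_num; first by rewrite phi_opp.
  exact: fin_between H1 (le_trans H2 H3).
rewrite J_opp leb_opp; split; last 2 first.
- by rewrite leeN2.
- by rewrite leeNl.
rewrite leeNr; apply: le_trans H3 _; rewrite -EFinN lee_fin; lra.
Qed.

End HermiteHadamard.

(** * From functionals to functions of one variable *)

Section Segment.
Local Open Scope ereal_scope.
Context {R : realType} {T : Type}.
Implicit Types (f g : T -> \bar R) (a b s t : R).

(** The weights are nonnegative and [-oo] is excluded, hence all the
    distributivity laws hold, with [0 * +oo = 0]. *)
Lemma nabla_nabla f g a b s : rtilde_functional f -> rtilde_functional g ->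
    (0 <= a <= 1)%R -> (0 <= b <= 1)%R -> (0 <= s <= 1)%R ->
  nabla s (nabla a f g) (nabla b f g) = nabla ((1 - s) * a + s * b)%R f g.
Proof.
move=> fNy gNy /andP[a0 a1] /andP[b0 b1] /andP[s0 s1].
apply/funext => x; rewrite /nabla.
have scaleNy r (u : \bar R) : (0 <= r)%R -> u != -oo -> r%:E * u != -oo.
  case: u => // + _; rewrite le_eqVlt => /predU1P[<-|r0]; first by rewrite mul0e.
  by rewrite gt0_muley.
have distr r p q : (0 <= p)%R -> (0 <= q)%R ->
    r%:E * (p%:E * f x + q%:E * g x) = (r * p)%:E * f x + (r * q)%:E * g x.
  move=> p0 q0; rewrite muleDr ?muleA ?EFinM//.
  by have := scaleNy _ _ p0 (fNy x); have := scaleNy _ _ q0 (gNy x);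
     case: (p%:E * _) => [?||]; case: (q%:E * _).
rewrite !distr ?subr_ge0// addeACA -!ge0_muleDl ?lee_fin ?mulr_ge0 ?subr_ge0//.
by rewrite -!EFinD; congr (_%:E * _ + _); ring.
Qed.

End Segment.

Theorem corollary3p4 (R : realType)
    (H : completeNormedModType R[i]) (dot : {dot H for Num.conj})
    (normE : forall u : H, `|u| ^+ 2 = dot u u)
    (C : set (H -> \bar R)) (Phi : (H -> \bar R) -> (H -> \bar R))
    (C_rtilde : C `<=` rtilde_functional)
    (C_nonempty : C !=set0)
    (C_convex : convex_functionals C)
    (Phi_rtilde : forall f, C f -> rtilde_functional (Phi f)) :
  (pointwise_convex C Phi -> forall f g, C f -> C g ->
    [/\ fle (Phi (nabla 2^-1 f g)) (mean_lebesgue Phi f g),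
        fle (mean_lebesgue Phi f g) (mean_J Phi f g)
      & fle (mean_J Phi f g) (nabla 2^-1 (Phi f) (Phi g))]) /\
  (pointwise_concave C Phi -> forall f g, C f -> C g ->
    [/\ fle (nabla 2^-1 (Phi f) (Phi g)) (mean_J Phi f g),
        fle (mean_J Phi f g) (mean_lebesgue Phi f g)
      & fle (mean_lebesgue Phi f g) (Phi (nabla 2^-1 f g))]).
Proof.
have PhiNy f g x (Cf : C f) (Cg : C g) t : 0 <= t <= 1 ->
    Phi (nabla t f g) x != -oo%E.
  by move=> t01; exact/Phi_rtilde/C_convex.
split=> PhiC f g Cf Cg.
- have HH x : [/\ (Phi (nabla 2^-1 f g) x <= mean_lebesgue Phi f g x)%E,
      (mean_lebesgue Phi f g x <= mean_J Phi f g x)%E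
    & (mean_J Phi f g x <= nabla 2^-1 (Phi f) (Phi g) x)%E].
    have := @convex01_hermite_hadamard _ (fun t => Phi (nabla t f g) x).
    rewrite nabla0 nabla1; apply; last exact: PhiNy.
    move=> a b s a01 b01 s01.
    rewrite -nabla_nabla//; [|exact: C_rtilde..].
    by apply: PhiC => //; exact: C_convex.
  by split=> x; case: (HH x).
- have HH x : [/\ (nabla 2^-1 (Phi f) (Phi g) x <= mean_J Phi f g x)%E,
      (mean_J Phi f g x <= mean_lebesgue Phi f g x)%E
    & (mean_lebesgue Phi f g x <= Phi (nabla 2^-1 f g) x)%E].
    have := @concave01_hermite_hadamard _ (fun t => Phi (nabla t f g) x).
    rewrite nabla0 nabla1; apply; last exact: PhiNy.
    move=> a b s a01 b01 s01.
    rewrite -nabla_nabla//; [|exact: C_rtilde..].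
    by apply: PhiC => //; exact: C_convex.
  by split=> x; case: (HH x).
Qed.
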